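(* Let ${\cal H}_1=\{1324,2314,2413,3124,3142,3214\}$, ${\cal H}_2=\{1234,1243,1324,1423,2314,3124\}$, ${\cal H}_3=\{2341,2413,2431,3412,3421,4231\}$, ${\cal H}_4=\{2134,2143,2314,3124,3214,4213\}$ and ${\cal H}_5=\{1234,1243,1324,1423,2134,3124\}$. For every integer $n\ge 2$ and each $i\in\{1,\dots,5\}$ there is a bijection between $F_n^{1,3}$ and $S_{n-1}({\cal H}_i)$.
   Context: A Dyck path of semilength $n$ is a lattice path from $(0,0)$ to $(2n,0)$ with steps $(1,1)$ and $(1,-1)$ never going below the $x$-axis; its first rise is the length of its maximal initial run of $(1,1)$ steps. $F_n^{1,3}$ (generalized Fine sequences congruous to one modulo three) is the set of Dyck paths of semilength $n$ whose first rise is congruent to $1$ modulo $3$. A permutation $\pi$ of $[m]$ contains a pattern $\tau$ (a permutation of $[k]$) if some subsequence $\pi(i_1)\cdots\pi(i_k)$ with $i_1<\dots<i_k$ is order-isomorphic to $\tau$; otherwise it avoids $\tau$. $S_m({\cal E})$ is the set of permutations of $[m]$ avoiding every pattern in ${\cal E}$. *)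

(* Defs.v *)
From mathcomp Require Import all_boot all_order all_fingroup.
Set Implicit Arguments. Unset Strict Implicit. Unset Printing Implicit Defensive.

(* Dyck paths: sequences of steps, true = up step (1,1), false = down (1,-1). *)
Definition dyckb (s : seq bool) : bool :=
  all (fun i => count_mem false (take i s) <= count_mem true (take i s))
      (iota 0 (size s).+1)
  && (count_mem true s == count_mem false s).

Definition first_rise (s : seq bool) : nat := find (fun b => ~~ b) s.

Definition F13 (n : nat) : Type :=
  {p : (n.*2).-tuple bool | dyckb p && (first_rise p %% 3 == 1)}.

(* A pattern is given in one-line notation as a sequence of naturals,
   e.g. [:: 1;3;2;4] for 1324. A permutation pi of [m] is a {perm 'I_m}. *)
Definition containsb (m : nat) (pi : {perm 'I_m}) (tau : seq nat) : bool :=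
  [exists f : {ffun 'I_(size tau) -> 'I_m},
     [forall a : 'I_(size tau), forall b : 'I_(size tau),
        ((a < b) ==> (f a < f b)) &&
        ((pi (f a) < pi (f b)) == (nth 0 tau a < nth 0 tau b))]].

Definition Av (m : nat) (E : seq (seq nat)) : Type :=
  {s : {perm 'I_m} | all (fun tau => ~~ containsb s tau) E}.

Definition H1 : seq (seq nat) :=
  [:: [:: 1;3;2;4]; [:: 2;3;1;4]; [:: 2;4;1;3]; [:: 3;1;2;4]; [:: 3;1;4;2]; [:: 3;2;1;4]].
Definition H2 : seq (seq nat) :=
  [:: [:: 1;2;3;4]; [:: 1;2;4;3]; [:: 1;3;2;4]; [:: 1;4;2;3]; [:: 2;3;1;4]; [:: 3;1;2;4]].
Definition H3 : seq (seq nat) :=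
  [:: [:: 2;3;4;1]; [:: 2;4;1;3]; [:: 2;4;3;1]; [:: 3;4;1;2]; [:: 3;4;2;1]; [:: 4;2;3;1]].
Definition H4 : seq (seq nat) :=
  [:: [:: 2;1;3;4]; [:: 2;1;4;3]; [:: 2;3;1;4]; [:: 3;1;2;4]; [:: 3;2;1;4]; [:: 4;2;1;3]].
Definition H5 : seq (seq nat) :=
  [:: [:: 1;2;3;4]; [:: 1;2;4;3]; [:: 1;3;2;4]; [:: 1;4;2;3]; [:: 2;1;3;4]; [:: 3;1;2;4]].

(* Main.v *)
(* A permutation grows by inserting its new maximum at a site. For patterns of length 4, whether
   two successive insertions are both allowed depends on the old elements, but a third insertion
   only adds conditions involving one old element, hence only the order of the sites. So the
   relation "site c stays active after an insertion at site a" on the k active sites evolves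
   autonomously. For each of the five classes (the first one after complementation) it takes only
   two forms A_k and B_k, with root A_1, and the generating trees are:
     classes 1-4:  A_k -> A_(k+1), B_3, ..., B_(k+1);      B_k -> A_1, A_k, B_3, ..., B_k;
     class 5:      A_k -> A_3, ..., A_(k+1), B_(k+1) (k > 1), A_1 -> A_2;
                   B_k -> A_1 (k - 2 times), A_3, B_3.
   On the Dyck side, decomposing after the first rise, of length 3i + 1, gives
   \sum_n |F_n^{1,3}| x^(n-1) = G := \sum_i x^(3i) C^(3i+1), with C the Catalan series. In both
   trees the series of A_k is (1 + x) G C^(k-1) - x G, so that A_1 has
   series G; in the first tree the series of B_k is (1 + x) G C^(k-2). *)

Require Import Defs.
From mathcomp Require Import all_boot all_order all_fingroup.
From mathcomp Require Import zify.
Set Implicit Arguments. Unset Strict Implicit. Unset Printing Implicit Defensive.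

(** * Insertion of a maximum, seen on the inverse permutation *)

(* [e], [f], [g], [h] are the positions of the values 1, 2, 3, 4 of a candidate pattern. *)
Definition forbidden (E : seq (seq nat)) (e f g h : nat) : bool :=
  has (fun tau => sorted ltn [seq nth h [:: e; f; g] t.-1 | t <- tau]) E.

Lemma forbidden_ext E e f g h e' f' g' h' :
  (forall i j, i < 4 -> j < 4 ->
     (nth 0 [:: e; f; g; h] i < nth 0 [:: e; f; g; h] j) =
     (nth 0 [:: e'; f'; g'; h'] i < nth 0 [:: e'; f'; g'; h'] j)) ->
  forbidden E e f g h = forbidden E e' f' g' h'.
Proof.
move=> H; apply: eq_has => tau; rewrite !sorted_map.
(* The letter 4 is read through the default of [nth], hence the cap of the index at 3. *)
have nth4 x y z w i : nth w [:: x; y; z] i = nth 0 [:: x; y; z; w] (minn i 3).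
  by case: i => [|[|[|i]]] //=; rewrite nth_nil.
have Hs (s : seq nat) : sorted (relpre (fun t => nth h [:: e; f; g] t.-1) ltn) s =
  sorted (relpre (fun t => nth h' [:: e'; f'; g'] t.-1) ltn) s.
  by apply: eq_sorted => x y /=; rewrite !nth4 H // ltnS geq_minr.
exact: Hs.
Qed.

Lemma forbidden_mono E F e f g h :
  {in [:: e; f; g; h] &, {mono F : x y / x < y}} ->
  forbidden E (F e) (F f) (F g) (F h) = forbidden E e f g h.
Proof.
move=> HF; apply: forbidden_ext => i j i4 j4.
have hn k : k < 4 -> nth 0 [:: F e; F f; F g; F h] k = F (nth 0 [:: e; f; g; h] k).
  by move: k => [|[|[|[|]]]].
by rewrite !hn // HF // mem_nth.
Qed.

(* [q] lists the positions of the values 0, 1, ... of a permutation, that is, its inverse. *)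
Definition avoids E (q : seq nat) : bool :=
  all (fun d => all (fun c => all (fun b => all (fun a =>
    ~~ forbidden E (nth 0 q a) (nth 0 q b) (nth 0 q c) (nth 0 q d))
  (iota 0 b)) (iota 0 c)) (iota 0 d)) (iota 0 (size q)).

(* [active], [active2] and [active3] test the patterns whose last one, two or three values are
   inserted at the cuts [i], then [j], then [l], each cut being read after the previous ones. *)
Definition active E (q : seq nat) (i : nat) : bool :=
  all (fun c => all (fun b => all (fun a =>
    ~~ forbidden E (bump i (nth 0 q a)) (bump i (nth 0 q b)) (bump i (nth 0 q c)) i)
  (iota 0 b)) (iota 0 c)) (iota 0 (size q)).

Definition active2 E (q : seq nat) (i j : nat) : bool :=
  all (fun b => all (fun a =>
    ~~ forbidden E (bump j (bump i (nth 0 q a))) (bump j (bump i (nth 0 q b))) (bump j i) j)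
  (iota 0 b)) (iota 0 (size q)).

Definition active3 E (q : seq nat) (i j l : nat) : bool :=
  all (fun e => ~~ forbidden E (bump l (bump j (bump i e))) (bump l (bump j i)) (bump l j) l) q.

(** The new maximum shifts the positions from [i] on; its own position comes last because [q] is
    indexed by values. *)
Definition child (q : seq nat) (i : nat) : seq nat := rcons (map (bump i) q) i.

Lemma size_child q i : size (child q i) = (size q).+1.
Proof. by rewrite size_rcons size_map. Qed.

Lemma nth_child q i a : a < size q -> nth 0 (child q i) a = bump i (nth 0 q a).
Proof. by move=> aq; rewrite nth_rcons size_map aq (nth_map 0). Qed.

Lemma nth_child_last q i : nth 0 (child q i) (size q) = i.
Proof. by rewrite nth_rcons size_map ltnn eqxx. Qed.

Lemma all_iotaS P n : all P (iota 0 n.+1) = all P (iota 0 n) && P n.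
Proof. by rewrite -addn1 iotaD all_cat /= andbT. Qed.

Lemma eq_all_iota (P Q : pred nat) n :
  (forall i, i < n -> P i = Q i) -> all P (iota 0 n) = all Q (iota 0 n).
Proof. by move=> PQ; apply: eq_in_all => i; rewrite mem_iota => /PQ. Qed.

(** Occurrences without the new maximum survive unchanged since [bump i] is increasing; those with
    it are what [active] tests. *)
Lemma avoids_child E q i : avoids E (child q i) = avoids E q && active E q i.
Proof.
rewrite /avoids size_child all_iotaS; congr andb.
  apply: eq_all_iota => d dq; apply: eq_all_iota => c cd.
  apply: eq_all_iota => b bc; apply: eq_all_iota => a ab.
  rewrite !nth_child; try lia.
  by rewrite (forbidden_mono _ (F := bump i)) // => x y _ _; rewrite /bump; lia.
rewrite nth_child_last; apply: eq_all_iota => c cd.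
apply: eq_all_iota => b bc; apply: eq_all_iota => a ab.
by rewrite !nth_child; try lia.
Qed.

(** * Pulling cuts back by deleting an earlier insertion *)

Lemma unbump_mono h : {in predC1 h &, {mono unbump h : x y / x < y}}.
Proof. by move=> x y; rewrite !inE /unbump; lia. Qed.

Lemma unbump_bump2 j i x : unbump (bump j i) (bump j (bump i x)) = bump (unbump i j) x.
Proof. by rewrite bumpC bumpK. Qed.

Lemma unbump_bump_id j i : unbump (bump j i) j = unbump i j.
Proof. by rewrite /bump /unbump; lia. Qed.

Lemma bump2_neq j i x : bump j (bump i x) != bump j i.
Proof. by rewrite /bump; lia. Qed.

Lemma forbidden_unbump E h e f g k : all (predC1 h) [:: e; f; g; k] ->
  forbidden E e f g k = forbidden E (unbump h e) (unbump h f) (unbump h g) (unbump h k).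
Proof.
move=> /allP H; rewrite -[LHS](@forbidden_mono E (unbump h)) // => x y xs ys.
by rewrite unbump_mono //; exact: H.
Qed.

(** An occurrence either does not use the previous maximum, whose deletion turns [j] into
    [unbump i j], or has it as its letter 3. *)
Lemma active_child E q i j :
  active E (child q i) j = active E q (unbump i j) && active2 E q i j.
Proof.
rewrite /active size_child all_iotaS; congr andb.
  apply: eq_all_iota => c cd.
  apply: eq_all_iota => b bc; apply: eq_all_iota => a ab.
  rewrite !nth_child; try lia.
  rewrite (@forbidden_unbump E (bump j i)) ?unbump_bump2 ?unbump_bump_id //=.
  by rewrite !bump2_neq neq_bump.
rewrite nth_child_last; apply: eq_all_iota => b bc; apply: eq_all_iota => a ab.
by rewrite !nth_child; try lia.
Qed.

Lemma active2_child E q i j l :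
  active2 E (child q i) j l =
  active2 E q (unbump i j) (unbump (bump j i) l) && active3 E q i j l.
Proof.
rewrite /active2 size_child all_iotaS; congr andb.
  apply: eq_all_iota => b bc; apply: eq_all_iota => a ab.
  rewrite !nth_child; try lia.
  have del x : unbump (bump l (bump j i)) (bump l (bump j (bump i x))) =
      bump (unbump (bump j i) l) (bump (unbump i j) x).
    by rewrite (bumpC j i x) unbump_bump2.
  have dely : unbump (bump l (bump j i)) (bump l j) = bump (unbump (bump j i) l) (unbump i j).
    by rewrite -unbump_bump2; congr (unbump _ (bump _ _)); rewrite /bump /unbump; lia.
  rewrite (@forbidden_unbump E (bump l (bump j i))) ?del ?dely ?unbump_bump_id //=.
  by rewrite !(can_eq (bumpK l)) !bump2_neq neq_bump neq_bump.
rewrite nth_child_last /active3 -[in RHS](mkseq_nth 0 q) all_map.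
by apply: eq_all_iota => a ab; rewrite !nth_child.
Qed.

Lemma ltn_bump2 h i j : (bump h i < bump h j) = (i < j).
Proof. by rewrite !ltnNge leq_bump2. Qed.

Lemma ltn_bumpl h i j : (bump h i < j) = (i < unbump h j).
Proof. by rewrite !ltnNge leq_bump. Qed.

Lemma ltn_bump_self h i : (h < bump h i) = (h <= i).
Proof. by rewrite /bump; lia. Qed.

Lemma bump_ltn_self h i : (bump h i < h) = (i < h).
Proof. by rewrite /bump; lia. Qed.

(* [unbump] pulls the successive cuts [j] and [l] back to the permutation that contains [e]. *)
Lemma forbidden_cut_ext E e i j l e' i' j' l' :
  (i <= e) = (i' <= e') -> (unbump i j <= e) = (unbump i' j' <= e') ->
  (unbump i (unbump j l) <= e) = (unbump i' (unbump j' l') <= e') ->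
  (j <= i) = (j' <= i') -> (unbump j l <= i) = (unbump j' l' <= i') -> (l <= j) = (l' <= j') ->
  forbidden E (bump l (bump j (bump i e))) (bump l (bump j i)) (bump l j) l =
  forbidden E (bump l' (bump j' (bump i' e'))) (bump l' (bump j' i')) (bump l' j') l'.
Proof.
have lt_cut h x : (h < bump h x) = (h <= x) by rewrite /bump; lia.
have cut_lt h x : (bump h x < h) = ~~ (h <= x) by rewrite /bump; lia.
rewrite -!leq_bump => H1 H2 H3 H4 H5 H6.
apply: forbidden_ext => -[|[|[|[|//]]]] [|[|[|[|//]]]] _ _ /=;
  rewrite ?ltnn ?ltn_bump2 ?lt_cut ?cut_lt ?ltn_bump2 ?lt_cut ?cut_lt ?ltn_bump2 ?lt_cut ?cut_lt //;
  by congr negb.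
Qed.

(** * Sites and their two-step compatibility *)

(* When [p] lists the active sites, [cand p a] lists the candidates after an insertion at the
   site of index [a], which is split into the candidates [a] and [a.+1]. *)
Definition cand (p : nat -> nat) (a c : nat) : nat := if c <= a then p c else (p c.-1).+1.

Definition incr_on (k : nat) (p : nat -> nat) := forall a b, a < k -> b < k -> (p a < p b) = (a < b).

Lemma incr_on_leq k p : incr_on k p -> forall a b, a < k -> b < k -> (p a <= p b) = (a <= b).
Proof. by move=> H a b ak bk; rewrite leqNgt H // -leqNgt. Qed.

(** The two halves [a] and [a.+1] of the split site both pull back to [a]. *)
Lemma cand_unbump k p a c : incr_on k p -> a < k -> c <= k ->
  unbump (p a) (cand p a c) = p (unbump a c).
Proof.
move=> H ak ck; rewrite /cand /unbump; case: (leqP c a) => ca.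
  have pca : p c <= p a by rewrite (incr_on_leq H) //; lia.
  by rewrite subn0 ltnNge pca subn0.
have pac : p a <= p c.-1 by rewrite (incr_on_leq H); lia.
by rewrite ltnS pac !subn1.
Qed.

Lemma leq_cand k p a c : incr_on k p -> a < k -> c <= k -> (cand p a c <= p a) = (c <= a).
Proof.
move=> H ak ck; rewrite /cand; case: (leqP c a) => ca.
  by rewrite (incr_on_leq H) //; lia.
by rewrite H; lia.
Qed.

Lemma incr_cand k p a : incr_on k p -> a < k -> incr_on k.+1 (cand p a).
Proof.
move=> H ak b c bk ck; rewrite /cand.
case: (leqP b a) => ba; case: (leqP c a) => ca.
- by rewrite H //; lia.
- by rewrite ltnS (incr_on_leq H) //; lia.
- have := incr_on_leq H (a := c) (b := b.-1); lia.
- by rewrite ltnS H //; lia.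
Qed.

Lemma cand_bound k p m a : (forall w, w < k -> p w <= m) -> a < k ->
  forall w, w < k.+1 -> cand p a w <= m.+1.
Proof.
move=> H ak w wk; rewrite /cand; case: ifP => wa; first by apply: leqW; apply: H; lia.
by rewrite ltnS H //; lia.
Qed.

Lemma site_before k p e : incr_on k.+1 p -> p 0 <= e ->
  exists2 e', e' < k.+1 & forall w, w < k.+1 -> (p w <= e) = (w <= e').
Proof.
elim: k p => [|k IH] p H p0; first by exists 0 => // -[|w] //; rewrite p0.
have [||e' e'k He'] := IH p => //.
  by move=> a b ak bk; apply: H; lia.
case: (leqP (p k.+1) e) => [pe|pe].
  exists k.+1 => // w wk; rewrite [RHS]wk; apply: leq_trans pe.
  by rewrite (incr_on_leq H).
exists e' => [|w]; first by lia.
rewrite ltnS leq_eqVlt => /orP[/eqP->|wk]; last by rewrite He'.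
by rewrite leqNgt pe; lia.
Qed.

(** For patterns of length 4, no pattern of [E] starts (resp. ends) with the letter 1, so an old
    element outside all the cuts is harmless. *)
Definition no_left E := forall e x y z, e < x -> e < y -> e < z -> ~~ forbidden E e x y z.
Definition no_right E := forall e x y z, x < e -> y < e -> z < e -> ~~ forbidden E e x y z.

Lemma unbump_bound k a c : a < k -> c <= k -> unbump a c < k.
Proof. by rewrite /unbump; lia. Qed.

(* Every gap between consecutive sites contains an old element, so the [k] sites behave like all
   the cuts of a permutation of size [k.-1], provided the two outer gaps do not matter. *)
Lemma active3_sites E q m k p a c l :
  perm_eq q (iota 0 m) -> incr_on k p -> (forall w, w < k -> p w <= m) ->
  a < k -> c <= k -> l <= k.+1 ->
  no_left E \/ p 0 = 0 -> no_right E \/ p k.-1 = m ->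
  active3 E q (p a) (cand p a c) (cand (cand p a) c l) = active3 E (iota 0 k.-1) a c l.
Proof.
move=> qm pinc pm ak ck lk Hl Hr.
have qE e : (e \in q) = (e < m) by rewrite (perm_mem qm) mem_iota.
have p1inc := incr_cand pinc ak.
have uk := unbump_bound ak ck.
have lk' : unbump c l < k.+1 by apply: unbump_bound.
have vk : unbump a (unbump c l) < k by apply: unbump_bound.
have E1 := cand_unbump pinc ak ck.
have E2 : unbump (cand p a c) (cand (cand p a) c l) = cand p a (unbump c l) by apply: (cand_unbump p1inc).
have E3 := cand_unbump pinc ak lk'.
have same e e' : (forall w, w < k -> (p w <= e) = (w <= e')) ->
  forbidden E (bump (cand (cand p a) c l) (bump (cand p a c) (bump (p a) e)))
    (bump (cand (cand p a) c l) (bump (cand p a c) (p a)))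
    (bump (cand (cand p a) c l) (cand p a c)) (cand (cand p a) c l) =
  forbidden E (bump l (bump c (bump a e'))) (bump l (bump c a)) (bump l c) l.
  move=> He; apply: forbidden_cut_ext.
  - exact: He.
  - by rewrite E1 He.
  - by rewrite E2 E3 He.
  - by rewrite (leq_cand pinc).
  - by rewrite E2 (leq_cand pinc).
  - by rewrite (leq_cand p1inc).
case: k => // k in pinc pm ak ck lk Hr p1inc uk lk' vk same *.
apply/allP/allP => /= H e'.
  (* The old element just to the right of the cut [p e'] represents the gap after site [e']. *)
  rewrite mem_iota => /= ek; rewrite -(same (p e')).
    by apply: H; rewrite qE (leq_trans _ (pm e'.+1 _)) // pinc; lia.
  by move=> w wk; rewrite (incr_on_leq pinc) //; lia.
rewrite qE => em.
(* An old element before the first site or after the last one lies in no inner gap; such an outer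
   gap is harmless or empty. *)
have [p0e|ep0] := leqP (p 0) e'; last first.
  case: Hl => [nl|p00]; last by lia.
  have lo w : w < k.+1 -> e' < p w.
    by move=> wk; apply: leq_trans ep0 _; rewrite (incr_on_leq pinc).
  by apply: nl; rewrite ?ltn_bump2 ?bump_ltn_self ?ltn_bumpl ?E2 ?E3 ?E1 lo.
have [e ek He] := site_before pinc p0e.
case: (ltnP e k) => [ek'|ke].
  by rewrite (same _ _ He); apply: H; rewrite mem_iota.
have hi w : w < k.+1 -> p w <= e' by move=> wk; rewrite He //; lia.
case: Hr => [nr|pk]; last by have := hi k; rewrite pk; lia.
by apply: nr; rewrite ?ltn_bump2 ?ltn_bump_self ?leq_bump ?E2 ?E3 ?E1 hi.
Qed.

(* The three new elements get ranks among 1, 3, 5, and an old element in one of the four gaps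
   delimited by the cuts [w1 <= w2 <= w3] gets rank 0, 2, 4 or 6. *)
Definition gaps_allowed E n w1 w2 w3 x y z : bool :=
  [&& (0 < w1) ==> ~~ forbidden E 0 x y z, (w1 < w2) ==> ~~ forbidden E 2 x y z,
      (w2 < w3) ==> ~~ forbidden E 4 x y z & (w3 < n) ==> ~~ forbidden E 6 x y z].

(** An old element matters only through the number of cuts at or before it, and the leftmost element
    of each nonempty gap (0, [w1], [w2] or [w3]) speaks for that gap. *)
Lemma active3_sorted E n a c l w1 w2 w3 x y z :
  w1 <= w2 <= w3 -> w3 <= n ->
  (forall e, forbidden E (bump l (bump c (bump a e))) (bump l (bump c a)) (bump l c) l =
     forbidden E (2 * ((w1 <= e) + (w2 <= e) + (w3 <= e))) x y z) ->
  active3 E (iota 0 n) a c l = gaps_allowed E n w1 w2 w3 x y z.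
Proof.
move=> w123 w3n Hbad; apply/allP/and4P => [H|[H0 H1 H2 H3] e].
  have {}H e g : e < n -> (w1 <= e) + (w2 <= e) + (w3 <= e) = g -> ~~ forbidden E (2 * g) x y z.
    by move=> en <-; rewrite -Hbad; apply: H; rewrite mem_iota.
  split; apply/implyP => w.
  - by apply: (H 0 0); lia.
  - by apply: (H w1 1); lia.
  - by apply: (H w2 2); lia.
  - by apply: (H w3 3); lia.
rewrite mem_iota Hbad => en.
have pick (g : nat) b : (w1 <= e) + (w2 <= e) + (w3 <= e) = g ->
    b ==> ~~ forbidden E (2 * g) x y z -> b -> ~~ forbidden E (2 * ((w1 <= e) + (w2 <= e) + (w3 <= e))) x y z.
  by move=> -> /implyP.
have [we1|we1] : w1 <= e \/ e < w1 by lia.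
2: by apply: (pick 0 _ _ H0); lia.
have [we2|we2] : w2 <= e \/ e < w2 by lia.
2: by apply: (pick 1 _ _ H1); lia.
have [we3|we3] : w3 <= e \/ e < w3 by lia.
2: by apply: (pick 2 _ _ H2); lia.
by apply: (pick 3 _ _ H3); lia.
Qed.

(* The branches are the relative orders of the three cuts [a], [c], [l]; the first argument of
   [M] and the bounds of [gaps_allowed] are those cuts pulled back to the original permutation. *)
Definition compat_after E (M : nat -> nat -> bool) n a c l : bool :=
  if c <= a then
    if l <= c then M c l && gaps_allowed E n l c a 5 3 1
    else if l <= a.+1 then M c l && gaps_allowed E n c l.-1 a 5 1 3
    else M c l.-1 && gaps_allowed E n c a l.-2 3 1 5
  else
    if l <= a then M c.-1 l && gaps_allowed E n l a c.-1 3 5 1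
    else if l <= c then M c.-1 l.-1 && gaps_allowed E n a l.-1 c.-1 1 5 3
    else M c.-1 l.-1 && gaps_allowed E n a c.-1 l.-2 1 3 5.

Lemma compat_afterE E M n a c l : a <= n -> c <= n.+1 -> l <= n.+2 ->
  M (unbump a c) (unbump (bump c a) l) && active3 E (iota 0 n) a c l = compat_after E M n a c l.
Proof.
move=> an cn ln; rewrite /compat_after.
have canon e w1 w2 w3 x y z :
   (forall i j, i < 4 -> j < 4 ->
     (nth 0 [:: bump l (bump c (bump a e)); bump l (bump c a); bump l c; l] i <
      nth 0 [:: bump l (bump c (bump a e)); bump l (bump c a); bump l c; l] j) =
     (nth 0 [:: 2 * ((w1 <= e) + (w2 <= e) + (w3 <= e)); x; y; z] i <
      nth 0 [:: 2 * ((w1 <= e) + (w2 <= e) + (w3 <= e)); x; y; z] j)) ->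
   forbidden E (bump l (bump c (bump a e))) (bump l (bump c a)) (bump l c) l =
     forbidden E (2 * ((w1 <= e) + (w2 <= e) + (w3 <= e))) x y z by exact: forbidden_ext.
case: (leqP c a) => ca; [case: (leqP l c) => lc; last case: (leqP l a.+1) => la |
                         case: (leqP l a) => la; last case: (leqP l c) => lc];
  (congr andb; first by (congr M; rewrite /bump /unbump; lia));
  (apply: active3_sorted; try lia; move=> e; apply: canon => -[|[|[|[|//]]]] [|[|[|[|//]]]] _ _ /=);
  rewrite /bump; lia.
Qed.

(** * Succession rules *)

(* [(true, k)] stands for A_k and [(false, k)] for B_k. *)
Definition state := (bool * nat)%type.

Definition state_wf (s : state) : bool := if s.1 then 0 < s.2 else 2 < s.2.

(* [compat s a c]: the candidate [c] stays active after an insertion at the site [a];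
   [kept s a] enumerates the candidates that do. *)
Record rule := Rule {
  compat : state -> nat -> nat -> bool;
  succ_state : state -> nat -> state;
  kept : state -> nat -> nat -> nat }.

(* [keepL] (resp. [keepR]) requires the first (resp. last) site to be the leftmost (resp.
   rightmost) cut; otherwise the corresponding outer gap has to be harmless. *)
Record sound E (r : rule) (keepL keepR : bool) : Prop := Sound {
  succ_state_wf : forall s a, state_wf s -> a < s.2 -> state_wf (succ_state r s a);
  kept_bound : forall s a b, state_wf s -> a < s.2 -> b < (succ_state r s a).2 -> kept r s a b <= s.2;
  kept_incr : forall s a b b', state_wf s -> a < s.2 ->
    b < (succ_state r s a).2 -> b' < (succ_state r s a).2 -> (kept r s a b < kept r s a b') = (b < b');
  kept_compat : forall s a b, state_wf s -> a < s.2 -> b < (succ_state r s a).2 ->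
    compat r s a (kept r s a b);
  compat_kept : forall s a c, state_wf s -> a < s.2 -> c <= s.2 -> compat r s a c ->
    exists2 b, b < (succ_state r s a).2 & c = kept r s a b;
  succ_state_compat : forall s a b d, state_wf s -> a < s.2 ->
    b < (succ_state r s a).2 -> d <= (succ_state r s a).2 ->
    compat r (succ_state r s a) b d =
    compat_after E (compat r s) s.2.-1 a (kept r s a b) (cand (kept r s a) b d);
  compat_root : forall c, c <= 1 -> compat r (true, 1) 0 c;
  left_ok : if keepL then forall s a, state_wf s -> a < s.2 -> kept r s a 0 = 0 else no_left E;
  right_ok : if keepR then forall s a, state_wf s -> a < s.2 ->
      kept r s a (succ_state r s a).2.-1 = s.2 else no_right E }.

(** The invariant of the generating tree: [p] lists the active sites of [q], and their two-step
    compatibilities are those prescribed by the label [s]. *)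
Record has_state E (r : rule) (keepL keepR : bool) (q : seq nat) (s : state) (p : nat -> nat) : Prop :=
 HasState {
  st_perm : perm_eq q (iota 0 (size q));
  st_wf : state_wf s;
  st_incr : incr_on s.2 p;
  st_bound : forall w, w < s.2 -> p w <= size q;
  st_active : forall w, w < s.2 -> active E q (p w);
  st_sites : forall i, i <= size q -> active E q i -> exists2 w, w < s.2 & i = p w;
  st_compat : forall a c, a < s.2 -> c <= s.2 -> active2 E q (p a) (cand p a c) = compat r s a c;
  st_left : keepL -> p 0 = 0;
  st_right : keepR -> p s.2.-1 = size q }.

Lemma or_of_if (b : bool) (P Q R : Prop) : (if b then P else Q) -> (b -> R) -> Q \/ R.
Proof. by case: b; auto. Qed.

Lemma state_wf_gt0 s : state_wf s -> 0 < s.2.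
Proof. by case: s => -[] []. Qed.

Lemma perm_child (q : seq nat) (i : nat) : perm_eq q (iota 0 (size q)) -> i <= size q ->
  perm_eq (child q i) (iota 0 (size q).+1).
Proof.
move=> qm im; have uq : uniq q by rewrite (perm_uniq qm) iota_uniq.
have qE (e : nat) : (e \in q) = (e < size q) by rewrite (perm_mem qm) mem_iota.
have memC (x : nat) : (x \in child q i) = (x < (size q).+1).
  rewrite mem_rcons inE.
  have [->|xi] := eqVneq x i; first by rewrite ltnS im.
  apply/mapP/idP => [[e]|xm].
    by rewrite qE => em ->; rewrite /bump; lia.
  exists (unbump i x); last by rewrite unbumpK // inE.
  by rewrite qE /unbump; lia.
apply: uniq_perm; rewrite ?iota_uniq //; last by move=> x; rewrite memC mem_iota.
rewrite rcons_uniq map_inj_uniq ?uq ?andbT; last exact: can_inj (bumpK i).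
by apply/mapP => -[e _ /eqP]; rewrite (negPf (neq_bump _ _)).
Qed.

(** Forgetting the first of two insertions acts in the same way on cuts and on indices of sites. *)
Lemma cand_unbump2 k p a c l : incr_on k p -> a < k -> c <= k -> l <= k.+1 ->
  unbump (bump (cand p a c) (p a)) (cand (cand p a) c l) =
  cand p (unbump a c) (unbump (bump c a) l).
Proof.
move=> pinc ak ck lk; have p1inc := incr_cand pinc ak.
have [ca|ac] := leqP c a.
  have -> : bump c a = a.+1 by rewrite /bump; lia.
  have -> : bump (cand p a c) (p a) = (p a).+1.
    by rewrite /bump (leq_cand pinc) // ca.
  have -> : unbump a c = c by rewrite /unbump; lia.
  rewrite /cand.
  have [lc|cl] := leqP l c.
    have la : l <= a by lia.
    have pla : p l <= p a by rewrite (incr_on_leq pinc); lia.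
    by rewrite la /unbump !ltnNge !leqW // !subn0 lc.
  have [la|al] := leqP l.-1 a.
    have pla : p l.-1 <= p a by rewrite (incr_on_leq pinc); lia.
    have -> : unbump a.+1 l = l by rewrite /unbump; lia.
    by rewrite leqNgt cl /= /unbump; lia.
  have pla : p a <= p l.-2 by rewrite (incr_on_leq pinc); lia.
  have -> : unbump a.+1 l = l.-1 by rewrite /unbump; lia.
  by rewrite ifF /unbump; lia.
have -> : bump c a = a by rewrite /bump; lia.
have -> : bump (cand p a c) (p a) = p a.
  by rewrite /bump (leq_cand pinc) // leqNgt ac.
have -> : unbump a c = c.-1 by rewrite /unbump; lia.
rewrite /cand.
have [la|al] := leqP l a.
  have pla : p l <= p a by rewrite (incr_on_leq pinc); lia.
  have -> : unbump a l = l by rewrite /unbump; lia.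
  have lc : l <= c by lia.
  have lc' : l <= c.-1 by lia.
  by rewrite lc lc' /unbump; lia.
have -> : unbump a l = l.-1 by rewrite /unbump; lia.
have [lc|cl] := leqP l c.
  have pla : p a <= p l.-1 by rewrite (incr_on_leq pinc); lia.
  have lc' : l.-1 <= c.-1 by lia.
  by rewrite lc' /unbump; lia.
have pla : p a <= p l.-2 by rewrite (incr_on_leq pinc); lia.
rewrite ifF; last by lia.
by rewrite ifF /unbump; lia.
Qed.

(** The new active sites are the compatible candidates. Their compatibilities combine the old ones
    with [active3], which depends only on indices by [active3_sites]; this is what makes the labels
    autonomous. *)
Lemma has_state_child E r keepL keepR q s p a : sound E r keepL keepR ->
  has_state E r keepL keepR q s p -> a < s.2 ->
  has_state E r keepL keepR (child q (p a)) (succ_state r s a) (fun b => cand p a (kept r s a b)).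
Proof.
move=> Sr [qm wf pinc pb pact psites pcomp pl pr] ak.
have p1inc := incr_cand pinc ak.
have wf' := succ_state_wf Sr wf ak.
have kb b := kept_bound Sr (b := b) wf ak.
have ki : incr_on (succ_state r s a).2 (kept r s a) := fun b b' => kept_incr Sr wf ak.
have k0' := state_wf_gt0 wf'.
split; rewrite ?size_child //.
- by apply: perm_child; rewrite ?pb.
- by move=> b c bk ck /=; rewrite p1inc ?ltnS ?kb // ki.
- by move=> w wk; apply: (cand_bound pb); rewrite ?ltnS ?kb.
- move=> w wk; rewrite active_child (cand_unbump pinc) ?kb // pact ?pcomp ?kb ?(kept_compat Sr) //.
  by rewrite unbump_bound ?kb.
- move=> i im; rewrite active_child => /andP[ai a2i].
  have [|w wk iE] := psites _ _ ai; first by rewrite -ltnS unbump_bound ?ltnS ?pb.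
  (* A cut pulling back to site [w] is candidate [w] up to the insertion and [w.+1] after it. *)
  have [c ck iC] : exists2 c, c <= s.2 & i = cand p a c.
    have [ia|ai'] := leqP i (p a).
      exists w; first exact: ltnW.
      have iw : i = p w by rewrite -iE /unbump; lia.
      by rewrite /cand -(incr_on_leq pinc) // -iw ia.
    have iw : i = (p w).+1 by rewrite -iE /unbump; lia.
    have aw : a <= w by rewrite -(incr_on_leq pinc) //; lia.
    by exists w.+1; rewrite // /cand ltnNge aw.
  have cc : compat r s a c by rewrite -pcomp // -iC.
  by have [b bk cb] := compat_kept Sr wf ak ck cc; exists b; rewrite // iC cb.
- move=> b d bk dk.
  have -> : cand (fun b => cand p a (kept r s a b)) b d =
     cand (cand p a) (kept r s a b) (cand (kept r s a) b d).
    rewrite /cand -/(cand p a _); have [db|bd] := leqP d b.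
      by rewrite (incr_on_leq ki) ?db //; lia.
    have bd1 : b <= d.-1 by lia.
    by rewrite ltnNge (incr_on_leq ki) ?bd1 //; lia.
  set c := kept r s a b; set l := cand (kept r s a) b d.
  have ck : c <= s.2 by apply: kb.
  have lk : l <= s.2.+1 by exact: (cand_bound kb bk).
  rewrite active2_child (cand_unbump pinc) // (cand_unbump2 pinc) // pcomp.
  + rewrite (succ_state_compat Sr) // -compat_afterE; try lia.
    congr andb; apply: (active3_sites qm) => //.
      exact: or_of_if (left_ok Sr) pl.
    exact: or_of_if (right_ok Sr) pr.
  + exact: unbump_bound.
  + by rewrite -ltnS; apply: unbump_bound => //; rewrite /bump; lia.
- by move=> kl; move: (left_ok Sr) (pl kl); rewrite kl => -> // p0; rewrite /cand.
- move=> kr; move: (right_ok Sr) (pr kr); rewrite kr => -> // p0.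
  by rewrite /cand leqNgt ak /= p0.
Qed.

(** * The five classes *)

Definition rule1 := Rule
  (fun s a c => if s.1 || (a < s.2.-2) then (c <= a.+1) || (c == s.2)
                else if a == s.2.-2 then c == s.2 else c != s.2.-2)
  (fun s a => if s.1 then (if a == s.2.-1 then (true, s.2.+1) else (false, a.+3))
              else if a == s.2.-1 then (true, s.2)
              else if a == s.2.-2 then (true, 1) else (false, a.+3))
  (fun s a b => if s.1 then (if a == s.2.-1 then b else if b <= a.+1 then b else s.2)
              else if a == s.2.-1 then bump s.2.-2 b
              else if (a == s.2.-2) || (a.+1 < b) then s.2 else b).

(** The surviving candidates form an initial segment, so [kept] is the identity on indices; the same
    holds in [rule5]. *)
Definition rule2 := Rule
  (fun s a c => if s.1 then (a == 0) || (c <= a.+1)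
                else if a == s.2.-1 then c == 0
                else if a == 0 then c < s.2 else c <= a.+1)
  (fun s a => if s.1 then (if a == 0 then (true, s.2.+1) else (false, a.+2))
              else if a == 0 then (true, s.2)
              else if a == s.2.-1 then (true, 1) else (false, a.+2))
  (fun _ _ b => b).

Definition rule3 := Rule
  (fun s a c => if s.1 || (a < s.2.-2) then (c <= a) || (s.2.-1 <= c)
                else if a == s.2.-2 then c == s.2 else c != s.2.-2)
  (fun s a => if s.1 then (if a == s.2.-1 then (true, s.2.+1) else (false, a.+3))
              else if a == s.2.-1 then (true, s.2)
              else if a == s.2.-2 then (true, 1) else (false, a.+3))
  (fun s a b => if s.1 then (if a == s.2.-1 then b else if b <= a then b else b + s.2 - a.+2)
              else if a == s.2.-1 then bump s.2.-2 b
              else if a == s.2.-2 then s.2 else if b <= a then b else b + s.2 - a.+2).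

Definition rule4 := Rule
  (fun s a c => if s.1 then c <= a.+2
                else if a == s.2.-1 then c == s.2.-2 else (c <= a.+2) && (c < s.2))
  (fun s a => if s.1 then (if a == s.2.-1 then (true, s.2.+1) else (false, a.+3))
              else if a == s.2.-1 then (true, 1)
              else if a == s.2.-2 then (true, s.2) else (false, a.+3))
  (fun s a b => if ~~ s.1 && (a == s.2.-1) then s.2.-2 else b).

Definition rule5 := Rule
  (fun s a c => if s.1 then (a <= 1) || (c <= a) else if a <= 1 then c <= 2 else c == 0)
  (fun s a => if a == 0 then (true, if s.1 then s.2.+1 else 3)
              else if a == 1 then (false, if s.1 then s.2.+1 else 3)
              else (true, if s.1 then a.+1 else 1))
  (fun _ _ b => b).

(** Each letter [t] of [H1] becomes [5 - t], in the same order, so that this list is convertible to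
    the image of [H1]. *)
Definition H1_complement :=
  [:: [:: 4;2;3;1]; [:: 3;2;4;1]; [:: 3;1;4;2]; [:: 2;4;3;1]; [:: 2;4;1;3]; [:: 2;3;4;1]].

(** Innermost conditions are split first, and contradictory branches are closed at once to curb the
    case analysis. *)
Ltac split_if := repeat match goal with
  | |- context [if ?b then _ else _] => lazymatch b with
      | context [if _ then _ else _] => fail
      | _ => case: (boolP b) => ? /=; try (exfalso; lia) end
  end.

Ltac solve_succ_wf := move=> [[] k] a; rewrite /state_wf /=; split_if; lia.
Ltac solve_kept := move=> [[] k] a b; rewrite /state_wf /= /bump; split_if; lia.
Ltac solve_incr := move=> [[] k] a b b'; rewrite /state_wf /= /bump; split_if; lia.
(** The pattern tests of [gaps_allowed] bear on constant ranks, so they compute and leave linear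
    arithmetic on indices. *)
Ltac solve_succ_compat := move=> [[] k] a b d;
  rewrite /state_wf /= /compat_after /gaps_allowed /forbidden /= /cand /= /bump => ? ?;
  split_if; lia.
Ltac solve_edge := move=> e x y z ex ey ez; rewrite /forbidden /=; lia.

Lemma sound2 : sound H2 rule2 true false.
Proof.
split => //.
- solve_succ_wf.
- solve_kept.
- solve_kept.
- by case=> -[] k a c; rewrite /state_wf /= => wf ak ck H; exists c;
      move: H => //; split_if; lia.
- solve_succ_compat.
- solve_edge.
Qed.

Lemma sound5 : sound H5 rule5 true false.
Proof.
split => //.
- solve_succ_wf.
- solve_kept.
- solve_kept.
- by case=> -[] k a c; rewrite /state_wf /= => wf ak ck H; exists c;
      move: H => //; split_if; lia.
- solve_succ_compat.
- solve_edge.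
Qed.

Lemma sound4 : sound H4 rule4 false false.
Proof.
split => //.
- solve_succ_wf.
- solve_kept.
- solve_incr.
- solve_kept.
- case=> -[] k a c; rewrite /state_wf /= => wf ak ck H.
    by exists c;
      move: H => //; split_if; lia.
  exists (if a == k.-1 then 0 else c); move: H; split_if; lia.
- solve_succ_compat.
- by case=> [|[|]].
- solve_edge.
- solve_edge.
Qed.

Lemma sound1 : sound H1_complement rule1 false true.
Proof.
split => //.
- solve_succ_wf.
- solve_kept.
- solve_incr.
- solve_kept.
- case=> -[] k a c; rewrite /state_wf /= => wf ak ck H.
    by exists (if c <= a.+1 then c else if a == k.-1 then c else a.+2);
      move: H => //; split_if; lia.
  exists (if a == k.-1 then unbump k.-2 c else if a == k.-2 then 0
          else if c <= a.+1 then c else a.+2);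
    move: H; rewrite /bump /unbump; split_if; lia.
- solve_succ_compat.
- by case=> [|[|]].
- solve_edge.
- solve_kept.
Qed.

Lemma sound3 : sound H3 rule3 false true.
Proof.
split => //.
- solve_succ_wf.
- solve_kept.
- solve_incr.
- solve_kept.
- case=> -[] k a c; rewrite /state_wf /= => wf ak ck H.
    (* The witness inverts [kept]: the last two candidates, [k.-1] and [k], receive the indices
       [a.+1] and [a.+2]. *)
    by exists (if c <= a then c else if a == k.-1 then c else c + a.+2 - k);
      move: H => //; split_if; lia.
  exists (if a == k.-1 then unbump k.-2 c else if a == k.-2 then 0
          else if c <= a then c else c + a.+2 - k);
    move: H; rewrite /bump /unbump; split_if; lia.
- solve_succ_compat.
- by case=> [|[|]].
- solve_edge.
- solve_kept.
Qed.

(** * Enumeration of the avoiding permutations *)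

Definition children E (q : seq nat) : seq (seq nat) :=
  [seq child q i | i <- iota 0 (size q).+1 & active E q i].

Definition step E (l : seq (seq nat)) := flatten [seq children E q | q <- l].

Definition avoiders E m := iter m (step E) [:: [::]].

Lemma child_inj q q' i j : child q i = child q' j -> q = q' /\ i = j.
Proof.
by move=> /rcons_inj[+ ij]; rewrite ij => /(inj_map (can_inj (bumpK j))) ->.
Qed.

(** The last entry is the position of the maximum; [unbump] closes the hole left by its removal. *)
Lemma perm_child_inv (t : seq nat) m : perm_eq t (iota 0 m.+1) ->
  exists q i, [/\ t = child q i, i <= m & perm_eq q (iota 0 m)].
Proof.
move=> tm; have st : size t = m.+1 by rewrite (perm_size tm) size_iota.
have tE (e : nat) : (e \in t) = (e < m.+1) by rewrite (perm_mem tm) mem_iota.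
have ut : uniq t by rewrite (perm_uniq tm) iota_uniq.
case/lastP: t => // t' i in tm st tE ut *.
have im : i < m.+1 by rewrite -tE mem_rcons mem_head.
move: ut; rewrite rcons_uniq => /andP[it' ut'].
have Kt : map (bump i) (map (unbump i) t') = t'.
  rewrite -map_comp -[RHS]map_id; apply/eq_in_map => x xt' /=.
  by rewrite unbumpK // inE; apply: contra it' => /eqP <-.
exists (map (unbump i) t'), i; split=> //; first by rewrite /child Kt.
have memq (x : nat) : (x \in map (unbump i) t') = (x < m).
  rewrite -(mem_map (can_inj (bumpK i))) Kt.
  have -> : (bump i x \in t') = (bump i x \in rcons t' i).
    by rewrite mem_rcons inE eq_sym (negPf (neq_bump _ _)).
  by rewrite tE /bump; lia.
apply: uniq_perm; rewrite ?iota_uniq //; last by move=> x; rewrite memq mem_iota.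
by rewrite -(map_inj_uniq (can_inj (bumpK i))) Kt.
Qed.

Lemma mem_avoiders E m t : (t \in avoiders E m) = perm_eq t (iota 0 m) && avoids E t.
Proof.
elim: m t => [|m IH] t.
  rewrite inE; apply/eqP/andP => [->|[+ _]] //.
  by move/perm_size; case: t.
apply/flatten_mapP/andP => [[q]|[tm at']].
  rewrite -/(avoiders E m) IH => /andP[qm aq] /mapP[i].
  rewrite mem_filter mem_iota => /andP[ai /= im] ->.
  have sq : size q = m by rewrite (perm_size qm) size_iota.
  have im' : i <= size q by rewrite -ltnS.
  by rewrite avoids_child aq ai -sq; split=> //; apply: perm_child => //; rewrite sq.
have [q [i [tE im qm]]] := perm_child_inv tm.
have sq : size q = m by rewrite (perm_size qm) size_iota.
move: at'; rewrite tE avoids_child => /andP[aq ai].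
exists q; first by rewrite -/(avoiders E m) IH qm.
by apply: map_f; rewrite mem_filter ai mem_iota sq.
Qed.

Lemma uniq_avoiders E m : uniq (avoiders E m).
Proof.
elim: m => [|m IH] //; rewrite /avoiders iterS -/(avoiders E m) /step.
elim: (avoiders E m) IH => //= q l IHl /andP[ql ul]; rewrite cat_uniq IHl // andbT.
rewrite map_inj_uniq ?filter_uniq ?iota_uniq //=; last by move=> i j /child_inj[].
apply/hasPn => _ /flatten_mapP[q' q'l /mapP[i _ ->]].
apply/mapP => -[j _ /child_inj[qq' _]].
by move: ql; rewrite -qq' q'l.
Qed.

Lemma size_iter_step E d l :
  size (iter d (step E) l) = \sum_(q <- l) size (iter d (step E) [:: q]).
Proof.
elim: d l => [|d IH] l; first by rewrite big_const_seq count_predT iter_addn_0 mul1n.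
rewrite iterSr IH {1}/step; elim: l => [|q l IHl]; first by rewrite !big_nil.
by rewrite [RHS]big_cons -IHl iterSr [in RHS]IH /step /= cats0 big_cat.
Qed.

Lemma children_sites E r keepL keepR q s p : has_state E r keepL keepR q s p ->
  perm_eq (children E q) [seq child q (p a) | a <- iota 0 s.2].
Proof.
move=> [qm wf pinc pb pact psites _ _ _]; rewrite (map_comp (child q) p); apply: perm_map.
have memE (i : nat) : (i \in [seq i <- iota 0 (size q).+1 | active E q i]) = (i \in map p (iota 0 s.2)).
  rewrite mem_filter mem_iota; apply/andP/mapP => [[ai im]|[w]].
    have [|w wk ->] := psites i _ ai; first by lia.
    by exists w; rewrite ?mem_iota.
  by rewrite mem_iota => wk ->; rewrite pact //= ltnS pb.
apply: uniq_perm => //; first by rewrite filter_uniq ?iota_uniq.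
rewrite map_inj_in_uniq ?iota_uniq // => a b; rewrite !mem_iota => /= ak bk pab.
move: (incr_on_leq pinc ak bk) (incr_on_leq pinc bk ak).
by rewrite pab leqnn => ab ba; apply/eqP; rewrite eqn_leq -ab.
Qed.

(** Any solution [V] of the recurrence read off the rule counts the levels of the tree, since every
    child again has a state. *)
Lemma size_descendants E r keepL keepR (V : nat -> state -> nat) d q s p :
  sound E r keepL keepR -> (forall s, state_wf s -> V 0 s = 1) ->
  (forall d s, state_wf s -> V d.+1 s = \sum_(0 <= a < s.2) V d (succ_state r s a)) ->
  has_state E r keepL keepR q s p -> size (iter d (step E) [:: q]) = V d s.
Proof.
move=> Sr V0 VS; elim: d q s p => [|d IH] q s p st; first by rewrite V0 // (st_wf st).
rewrite iterSr size_iter_step /step /= cats0 (perm_big _ (children_sites st)) /= big_map.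
rewrite VS ?(st_wf st) // /index_iota subn0.
rewrite big_seq_cond [RHS]big_seq_cond; apply: eq_bigr => a; rewrite mem_iota andbT => ak.
by apply: IH; apply: (has_state_child Sr st).
Qed.

Lemma has_state_root E r keepL keepR : sound E r keepL keepR ->
  has_state E r keepL keepR [::] (true, 1) (fun=> 0).
Proof.
move=> Sr; split => //=.
- by case=> // -[].
- by case=> // _ _; exists 0.
- by case=> // c _ ck; rewrite (compat_root Sr).
Qed.

Lemma size_avoiders E r keepL keepR (V : nat -> state -> nat) m :
  sound E r keepL keepR -> (forall s, state_wf s -> V 0 s = 1) ->
  (forall d s, state_wf s -> V d.+1 s = \sum_(0 <= a < s.2) V d (succ_state r s a)) ->
  size (avoiders E m) = V m (true, 1).
Proof. by move=> Sr V0 VS; apply: size_descendants Sr V0 VS (has_state_root Sr). Qed.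

(** * Ballot numbers *)

(* Nonnegative lattice paths of length [L] from height [h] to the axis. *)
Fixpoint paths_to_axis (L h : nat) : nat :=
  if L is L'.+1 then paths_to_axis L' h.+1 + (if h is h'.+1 then paths_to_axis L' h' else 0) else h == 0.

(* Paths from height [h] with [d] up steps: the coefficient of x^d in C^(h+1). *)
Definition ballot (d h : nat) : nat := paths_to_axis (h + d.*2) h.

(** First-step decomposition, that is [C^(h+2) = C^(h+1) + x C^(h+3)]. *)
Lemma ballotSS d h : ballot d.+1 h.+1 = ballot d.+1 h + ballot d h.+2.
Proof. by rewrite /ballot !addSn !doubleS !addnS /= addnC. Qed.

Lemma ballotS0 d : ballot d.+1 0 = ballot d 1.
Proof. by rewrite /ballot doubleS add0n add1n; exact: addn0. Qed.

Lemma paths_to_axis_high L h : L < h -> paths_to_axis L h = 0.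
Proof. by elim: L h => [|L IH] [|h] //= Lh; rewrite !IH //; lia. Qed.

Lemma ballot0 h : ballot 0 h = 1.
Proof.
rewrite /ballot addn0; elim: h => [|h IH] //=.
by rewrite IH paths_to_axis_high.
Qed.

(* The coefficient of x^d in G C^h. *)
Fixpoint ballot3 (d h : nat) : nat :=
  ballot d h + (if d is d'.+3 then ballot3 d' h.+3 else 0).

Lemma ballot3_0 h : ballot3 0 h = 1.
Proof. by rewrite /= ballot0. Qed.

Lemma ballot3E d h : ballot3 d.+3 h = ballot d.+3 h + ballot3 d h.+3.
Proof. by []. Qed.

Lemma ballot3_small d h : d < 3 -> ballot3 d h = ballot d h.
Proof. by move: d => [|[|[|]]] //= _; rewrite addn0. Qed.

Arguments ballot3 : simpl never.

(** G is a combination of powers of C, so it inherits the relation of [ballotSS]; peeling off one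
    term of G costs three degrees, whence the strong induction. *)
Lemma ballot3SS d h : ballot3 d.+1 h.+1 = ballot3 d.+1 h + ballot3 d h.+2.
Proof.
elim/ltn_ind: d h => -[|[|[|d]]] IH h.
- by rewrite !ballot3_small // ballotSS.
- by rewrite !ballot3_small // ballotSS.
- by rewrite !ballot3E !ballot3_0 [ballot3 2 _]ballot3_small // ballotSS; lia.
- by rewrite [in LHS]ballot3E IH; [rewrite !ballot3E ballotSS; lia | lia].
Qed.

(* Coefficients of (1 + x)(G - x G C) = 1 + x G - x^2 G. *)
Lemma ballot3_base d : ballot3 d.+2 0 + ballot3 d 0 = ballot3 d.+1 1 + ballot3 d 1.
Proof.
case: d => [|[|d]].
- by rewrite !ballot3_small // !ballot0 ballotS0.
- rewrite ballot3E !ballot3_0 [ballot3 2 1]ballot3_small // ballotS0 !ballot3SS !ballot3_0; lia.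
- rewrite !ballot3E ballotS0 !ballot3SS; lia.
Qed.

Lemma ballot3_10 : ballot3 1 0 = 1.
Proof. by rewrite ballot3_small // ballotS0 ballot0. Qed.

Lemma ballot3_1 h : ballot3 1 h = h.+1.
Proof. by elim: h => [|h IH]; rewrite ?ballot3_10 // ballot3SS IH ballot3_0 addn1. Qed.

Lemma ballot3_leq0 d h : ballot3 d 0 <= ballot3 d h.
Proof.
case: d => [|d]; first by rewrite !ballot3_0.
by elim: h => // h IH; rewrite ballot3SS; lia.
Qed.

(** Telescoping of [ballot3SS], with the boundary terms placed so as to avoid subtraction. *)
Lemma sum_ballot3 d n :
  \sum_(0 <= a < n.+1) ballot3 d a.+1 + ballot3 d.+1 0 = ballot3 d.+1 n + ballot3 d 1.
Proof.
elim: n => [|n IH]; first by rewrite big_nat1 addnC.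
by rewrite big_nat_recr //= ballot3SS; lia.
Qed.

(** Coefficient of [x^d] in [(1 + x) G C^(k-1) - x G] for A_k and in [(1 + x) G C^(k-2)] for B_k.
    The truncated subtraction is exact by [ballot3_leq0]. *)
Definition descendants (d : nat) (s : bool * nat) : nat :=
  if d is d'.+1 then
    if s.1 then ballot3 d s.2.-1 + ballot3 d' s.2.-1 - ballot3 d' 0
    else ballot3 d s.2.-2 + ballot3 d' s.2.-2
  else 1.

(** The B terms telescope once for each term of the factor [1 + x], and [ballot3_base] reconciles
    the boundary terms. *)
Lemma descendantsA d n :
  descendants d.+1 (true, n.+1) =
  \sum_(0 <= a < n) descendants d (false, a.+3) + descendants d (true, n.+2).
Proof.
case: d => [|d].
  by rewrite /= sum_nat_const_nat !ballot3_1 !ballot3_0; lia.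
rewrite [RHS]/= big_split /=.
have := sum_ballot3 d.+1 n; have := sum_ballot3 d n; rewrite !big_nat_recr //=.
have := ballot3_base d; have := ballot3_leq0 d n.+1; have := ballot3_leq0 d.+1 n.
lia.
Qed.

Lemma descendantsB d n :
  descendants d.+1 (false, n.+3) =
  \sum_(0 <= a < n.+1) descendants d (false, a.+3) + descendants d (true, n.+3) + descendants d (true, 1).
Proof.
case: d => [|d].
  by rewrite /= sum_nat_const_nat !ballot3_1 !ballot3_0; lia.
rewrite [RHS]/= big_split /=.
have := sum_ballot3 d.+1 n.+1; have := sum_ballot3 d n.+1; rewrite !big_nat_recr //=.
have := ballot3_base d; have := ballot3_leq0 d n.+2; have := ballot3_leq0 d 0.
lia.
Qed.

Arguments descendants : simpl never.

Lemma descendants_root d : descendants d (true, 1) = ballot3 d 0.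
Proof. by case: d => [|d]; rewrite /descendants /= ?ballot3_0 // addnK. Qed.

Lemma count_rule1 d s : state_wf s ->
  descendants d.+1 s = \sum_(0 <= a < s.2) descendants d (succ_state rule1 s a).
Proof.
case: s => -[] [|k] //= wf.
  rewrite descendantsA big_nat_recr //= eqxx; congr addn.
  by apply: eq_big_nat => a /andP[_ ak]; rewrite ltn_eqF.
case: k => [|[|k]] // in wf *.
rewrite descendantsB addnAC [RHS]big_nat_recr //= [X in _ = X + _]big_nat_recr //= !eqxx [k.+1 == _]ltn_eqF //.
congr (_ + _ + _); apply: eq_big_nat => a /andP[_ ak].
by rewrite !ltn_eqF // ltnW.
Qed.

(** [rule1] and [rule3] keep different candidates but have convertible successor states. *)
Lemma count_rule3 d s : state_wf s ->
  descendants d.+1 s = \sum_(0 <= a < s.2) descendants d (succ_state rule3 s a).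
Proof. exact: count_rule1. Qed.

Lemma count_rule2 d s : state_wf s ->
  descendants d.+1 s = \sum_(0 <= a < s.2) descendants d (succ_state rule2 s a).
Proof.
case: s => -[] [|k] //= wf.
  by rewrite descendantsA big_nat_recl //= addnC.
case: k => [|[|k]] // in wf *.
rewrite descendantsB [RHS]big_nat_recl // [X in _ = _ + X]big_nat_recr //= eqxx.
rewrite addnA (addnC (descendants d (true, k.+3))).
congr (_ + _ + _); apply: eq_big_nat => a /andP[_ ak].
by rewrite ltn_eqF.
Qed.

Lemma count_rule4 d s : state_wf s ->
  descendants d.+1 s = \sum_(0 <= a < s.2) descendants d (succ_state rule4 s a).
Proof.
case: s => -[] [|k] //= wf.
  rewrite descendantsA big_nat_recr //= eqxx; congr addn.
  by apply: eq_big_nat => a /andP[_ ak]; rewrite ltn_eqF.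
case: k => [|[|k]] // in wf *.
rewrite descendantsB [RHS]big_nat_recr //= [X in _ = X + _]big_nat_recr //= !eqxx [k.+1 == _]ltn_eqF //.
congr (_ + _ + _); apply: eq_big_nat => a /andP[_ ak].
by rewrite !ltn_eqF // ltnW.
Qed.

(* The coefficient of x^d in x G. *)
Definition delayed_ballot3 (d : nat) : nat := if d is d'.+1 then ballot3 d' 0 else 0.

(** From [C - 1 = x C^2], the series satisfy [A_(k+1) - A_k = x (A_(k+2) + x G)]; these differences
    are summed. *)
Lemma descendantsA_sum d n :
  descendants d.+1 (true, n.+1) =
  \sum_(0 <= a < n.+1) descendants d (true, a.+2) + n * delayed_ballot3 d.
Proof.
elim: n => [|n IH]; first by rewrite descendantsA big_geq // big_nat1 mul0n addnC.
rewrite big_nat_recr //= mulSn.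
have -> : descendants d.+1 (true, n.+2) =
    descendants d.+1 (true, n.+1) + descendants d (true, n.+3) + delayed_ballot3 d; last by lia.
case: d {IH} => [|d]; rewrite /descendants /= !ballot3SS.
  by rewrite !ballot3_0; lia.
have := ballot3_leq0 d n.+2; have := ballot3_leq0 d.+1 n; rewrite ?ballot3SS; lia.
Qed.

(** In the fifth tree B_k has the children A_3 and B_3 of A_2, plus [k - 2] children A_1, each
    contributing [x G]. *)
Definition descendants5 (d : nat) (s : state) : nat :=
  if s.1 then descendants d s else descendants d (true, 2) + (s.2 - 2) * delayed_ballot3 d.

Lemma count_rule5 d s : state_wf s ->
  descendants5 d.+1 s = \sum_(0 <= a < s.2) descendants5 d (succ_state rule5 s a).
Proof.
rewrite /descendants5; case: s => -[] [|[|k]] //= wf.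
- by rewrite descendantsA big_geq // big_nat1.
- rewrite descendantsA_sum big_nat_recl // [X in _ + X + _]big_nat_recr //=.
  by rewrite [RHS]big_nat_recl // [X in _ = _ + X]big_nat_recl //=; lia.
case: k => // k in wf *.
rewrite descendantsA_sum !big_nat_recl //= big_geq //= sum_nat_const_nat descendants_root; lia.
Qed.

(** * Dyck paths with first rise congruent to 1 modulo 3 *)

Fixpoint dyck_from (h : nat) (s : seq bool) : bool :=
  match s with
  | [::] => h == 0
  | true :: s' => dyck_from h.+1 s'
  | false :: s' => if h is h'.+1 then dyck_from h' s' else false
  end.

Lemma dyck_fromE h s :
  all (fun i => count_mem false (take i s) <= h + count_mem true (take i s))
      (iota 0 (size s).+1)
    && (h + count_mem true s == count_mem false s) = dyck_from h s.
Proof.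
elim: s h => [|b s IH] h; first by rewrite /= addn0 eq_sym; case: h.
have -> : iota 0 (size (b :: s)).+1 = 0 :: [seq i.+1 | i <- iota 0 (size s).+1].
  by rewrite -(iotaDl 1).
have all_cons (P : pred nat) x l : all P (x :: l) = P x && all P l by [].
rewrite all_cons all_map; case: b => [|].
  transitivity (dyck_from h.+1 s) => //; rewrite -IH take0 andTb; congr andb.
    by apply: eq_all => i /=; rewrite add0n add1n addnS.
  by rewrite /= add0n add1n addnS.
case: h => [|h]; first by rewrite /= take0.
transitivity (dyck_from h s) => //; rewrite -IH take0 andTb; congr andb.
Qed.

Lemma dyckbE s : dyckb s = dyck_from 0 s.
Proof. exact: (dyck_fromE 0). Qed.

Fixpoint words (L : nat) : seq (seq bool) :=
  if L is L'.+1 then map (cons true) (words L') ++ map (cons false) (words L') else [:: [::]].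

Lemma mem_words L w : (w \in words L) = (size w == L).
Proof.
elim: L w => [|L IH] [|b w] //=; rewrite mem_cat.
  by apply/orP => -[] /mapP[].
rewrite eqSS -IH; apply/orP/idP => [[] /mapP[w' ? [_ ->]] //|wL].
by case: b; [left | right]; apply: map_f.
Qed.

Lemma uniq_words L : uniq (words L).
Proof.
elim: L => //= L IH; rewrite cat_uniq !map_inj_uniq ?IH; try by move=> ? ? [].
by rewrite andbT; apply/hasPn => _ /mapP[w _ ->]; apply/mapP => -[].
Qed.

Lemma card_tuple_words L (P : pred (seq bool)) :
  #|[pred t : L.-tuple bool | P t]| = count P (words L).
Proof.
rewrite cardE /enum_mem size_filter -enumT -(count_map val P); apply/seq.permP/uniq_perm.
- by rewrite map_inj_uniq ?enum_uniq //; apply: val_inj.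
- exact: uniq_words.
- move=> w; rewrite mem_words; apply/mapP/eqP => [[t _ ->]|sw]; first exact: size_tuple.
  by move/eqP: sw => sw; exists (Tuple sw); rewrite ?mem_enum.
Qed.

Lemma count_dyck_from L h : count (dyck_from h) (words L) = paths_to_axis L h.
Proof.
elim: L h => [|L IH] h; first by rewrite /= addn0.
rewrite /= count_cat !count_map -IH; congr addn; case: h => [|h] /=; last exact: IH.
exact: count_pred0.
Qed.

(** The starting height counts as already climbed: these words complete an initial run of [h] up
    steps. *)
Definition rises (L h : nat) : nat :=
  count (fun w => dyck_from h w && ((h + first_rise w) %% 3 == 1)) (words L).

Lemma risesS L h :
  rises L.+1 h = rises L h.+1 +
    (if h is h'.+1 then if h %% 3 == 1 then paths_to_axis L h' else 0 else 0).
Proof.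
rewrite /rises /= count_cat !count_map; congr addn.
  by apply: eq_count => w /=; rewrite /first_rise /= addnS.
case: h => [|h]; first exact: count_pred0.
have first0 w : preim (cons false)
    (fun w => dyck_from h.+1 w && ((h.+1 + first_rise w) %% 3 == 1)) w =
    dyck_from h w && (h.+1 %% 3 == 1) by rewrite -[in RHS](addn0 h.+1).
rewrite (eq_count first0) -count_dyck_from; case: ifP => _.
  by apply: eq_count => w; rewrite andbT.
by rewrite -(count_pred0 (words L)); apply: eq_count => w; rewrite andbF.
Qed.

Lemma rises_high L h : L < h -> rises L h = 0.
Proof.
move=> Lh; apply/eqP; rewrite -leqn0 -(paths_to_axis_high Lh) -count_dyck_from.
by apply: sub_count => w /andP[].
Qed.

(** Among the next three lengths only [h.+1] is a legal end of the rise, leaving [ballot d h]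
    completions; otherwise the rise reaches [h.+3], with the same residue. *)
Lemma rises_ballot3 d h : h %% 3 = 0 -> rises (h + d.+1.*2) h = ballot3 d h.
Proof.
elim/ltn_ind: d h => d IH h h3.
have h1 : h.+1 %% 3 = 1 by lia.
have h2 : h.+2 %% 3 = 2 by lia.
have nostart L : rises L.+1 h = rises L h.+1.
  by rewrite risesS; case: (h) h3 => [|h'] h3; rewrite ?h3 addn0.
rewrite doubleS !addnS nostart risesS h1 /= -/(ballot d h).
case: d IH => [|d] IH.
  by rewrite addn0 rises_high // ballot3_0 ballot0.
rewrite doubleS !addnS risesS h2 /= addn0.
case: d IH => [|[|d]] IH.
- by rewrite rises_high ?ballot3_small ?addn0.
- have h0 : h.+3 %% 3 = 0 by lia.
  by rewrite addn2 risesS h0 rises_high //= ballot3_small.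
rewrite ballot3E -IH; try lia.
by rewrite addnC; congr (_ + rises _ _); lia.
Qed.

Lemma card_F13 d : #|{: {p : (d.+1.*2).-tuple bool | dyckb p && (first_rise p %% 3 == 1)}}| = ballot3 d 0.
Proof.
rewrite card_sig (card_tuple_words _ (fun p => dyckb p && (first_rise p %% 3 == 1))).
rewrite -(rises_ballot3 _ (h := 0)) // add0n.
by apply: eq_count => w; rewrite dyckbE add0n.
Qed.

Lemma eq_card_bij (T1 T2 : finType) : #|T1| = #|T2| -> exists f : T1 -> T2, bijective f.
Proof.
move=> e; exists (fun x => enum_val (cast_ord e (enum_rank x))).
exists (fun y => enum_val (cast_ord (esym e) (enum_rank y))) => x.
  by rewrite enum_valK cast_ordK enum_rankK.
by rewrite enum_valK cast_ordKV enum_rankK.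
Qed.

(** * From permutations to lists of positions *)

Definition positions m (pi : {perm 'I_m}) : seq nat := [seq val (pi^-1%g v) | v <- enum 'I_m].

(** Occurrences are described by values, as in the lists of positions: [v t] plays the letter
    [t]. *)
Definition occurs m (pi : {perm 'I_m}) (tau : seq nat) (v : nat -> 'I_m) : Prop :=
  [/\ v 1 < v 2, v 2 < v 3, v 3 < v 4 & sorted ltn [seq val (pi^-1%g (v t)) | t <- tau]].

Lemma containsP m (pi : {perm 'I_m}) tau : perm_eq tau (iota 1 4) ->
  containsb pi tau <-> exists v, occurs pi tau v.
Proof.
move=> tauP.
have tauE (t : nat) : (t \in tau) = (0 < t < 5) by rewrite (perm_mem tauP) mem_iota.
have ut : uniq tau by rewrite (perm_uniq tauP) iota_uniq.
have st : size tau = 4 := perm_size tauP.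
case: tau st tauE ut {tauP} => [//|t0 [//|t1 [//|t2 [//|t3 [|//]]]]] _ tauE ut.
set tau := [:: t0; t1; t2; t3] in tauE ut *.
split=> [/existsP[f /forallP Hf]|[v [v12 v23 v34 srt]]].
  have {Hf} Hf (a b : 'I_4) : (a < b -> f a < f b) /\
      (pi (f a) < pi (f b)) = (nth 0 tau a < nth 0 tau b).
    by have /forallP/(_ b)/andP[/implyP H /eqP] := Hf a.
  have it t : t \in tau -> index t tau < 4 by rewrite -index_mem.
  have lt s t : s \in tau -> t \in tau -> s < t ->
    pi (f (inord (index s tau))) < pi (f (inord (index t tau))).
    by move=> sT tT lt_st; rewrite (Hf _ _).2 !inordK ?it // !nth_index.
  (* The letter [t] is played by the value found at the place chosen for the index of [t] in
     [tau]. *)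
  exists (fun t => pi (f (inord (index t tau)))); split; try by apply: lt; rewrite ?tauE.
  have -> : [seq val (pi^-1%g (pi (f (inord (index t tau))))) | t <- tau] =
            [seq val (f (inord (index t tau))) | t <- tau].
    by apply: eq_map => t; rewrite permK.
  have -> : [seq val (f (inord (index t tau))) | t <- tau] =
     [:: val (f (inord (index t0 tau))); val (f (inord (index t1 tau)));
         val (f (inord (index t2 tau))); val (f (inord (index t3 tau)))] by [].
  have ti i : i < 4 -> index (nth 0 tau i) tau = i by move=> i4; rewrite index_uniq.
  rewrite (ti 0 isT) (ti 1 isT) (ti 2 isT) (ti 3 isT).
  by rewrite /= !(Hf _ _).1 // !inordK.
have vlt s t : s \in tau -> t \in tau -> (v s < v t) = (s < t).
  rewrite !tauE; move: s t => [|[|[|[|[|//]]]]] [|[|[|[|[|//]]]]] //= _ _; lia.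
apply/existsP; exists [ffun i : 'I_4 => pi^-1%g (v (nth 0 tau i))].
apply/forallP => a; apply/forallP => b; rewrite !ffunE !permKV vlt ?mem_nth // eqxx andbT.
apply/implyP => ab.
have /(_ a b) := sorted_ltn_nth ltn_trans 0 srt.
by rewrite !inE !size_map !ltn_ord => /(_ isT isT ab); rewrite !(nth_map 0).
Qed.

Lemma size_positions m (pi : {perm 'I_m}) : size (positions pi) = m.
Proof. by rewrite size_map size_enum_ord. Qed.

Lemma nth_positions m (pi : {perm 'I_m}) (v : 'I_m) : nth 0 (positions pi) v = pi^-1%g v.
Proof. by rewrite (nth_map v) ?size_enum_ord // nth_ord_enum. Qed.

Lemma avoids_positions m (pi : {perm 'I_m}) E : all (fun tau => perm_eq tau (iota 1 4)) E ->
  all (fun tau => ~~ containsb pi tau) E = avoids E (positions pi).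
Proof.
move=> /allP EP; rewrite /avoids size_positions; apply/allP/allP => H.
  move=> d; rewrite mem_iota => dm; apply/allP => c; rewrite mem_iota => cd.
  apply/allP => b; rewrite mem_iota => bc; apply/allP => a; rewrite mem_iota => ab.
  apply/hasPn => tau tauE; apply: contra (H _ tauE) => srt; apply/containsP; first exact: EP.
  have am : a < m by lia.
  have bm : b < m by lia.
  have cm : c < m by lia.
  have dm' : d < m by lia.
  exists (fun t => nth (Ordinal dm') [:: Ordinal am; Ordinal bm; Ordinal cm] t.-1).
  split; try by move=> /=; lia.
  move: srt; congr (sorted _ _); apply: eq_map => t.
  case: t.-1 => [|[|[|k]]] /=; rewrite ?nth_nil.
  - exact: (nth_positions pi (Ordinal am)).
  - exact: (nth_positions pi (Ordinal bm)).
  - exact: (nth_positions pi (Ordinal cm)).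
  - exact: (nth_positions pi (Ordinal dm')).
move=> tau tauE; apply/negP => /(containsP _ (EP _ tauE))[v [v12 v23 v34 srt]].
have io n (x : 'I_n) k : x < k -> val x \in iota 0 k by rewrite mem_iota.
have /allP/(_ _ (io _ _ _ v34)) := H _ (io _ _ _ (ltn_ord (v 4))).
move=> /allP/(_ _ (io _ _ _ v23)) /allP/(_ _ (io _ _ _ v12)).
move=> /hasPn/(_ _ tauE)/negP[].
have {EP} t5 (t : nat) : t \in tau -> 0 < t < 5 by rewrite (perm_mem (EP _ tauE)) mem_iota.
move: srt; congr (sorted _ _); apply/eq_in_map => t /t5.
by move: t => [|[|[|[|[|//]]]]] //= _; rewrite nth_positions.
Qed.

Lemma perm_positions m (pi : {perm 'I_m}) : perm_eq (positions pi) (iota 0 m).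
Proof.
apply: uniq_perm; rewrite ?iota_uniq //.
  by rewrite map_inj_uniq ?enum_uniq // => x y /val_inj/perm_inj.
move=> x; rewrite mem_iota /= add0n; apply/mapP/idP => [[v _ ->]|xm]; first exact: ltn_ord.
by exists (pi (Ordinal xm)); rewrite ?mem_enum // permK.
Qed.

Lemma positions_inj m : injective (@positions m).
Proof.
move=> pi pi' e; apply: invg_inj; apply/permP => v; apply: val_inj.
by have := nth_positions pi v; rewrite e nth_positions => /= <-.
Qed.

(** Surjectivity by counting: [positions] is injective and both sides have [m!] elements. *)
Lemma mem_positions m (t : seq nat) : perm_eq t (iota 0 m) -> exists pi : {perm 'I_m}, t = positions pi.
Proof.
move=> tm.
have [|||_ mem_eq] := @uniq_min_size _ (map (@positions m) (enum {perm 'I_m})) (permutations (iota 0 m)).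
- by rewrite map_inj_uniq ?enum_uniq //; apply: positions_inj.
- by move=> _ /mapP[pi _ ->]; rewrite mem_permutations perm_positions.
- by rewrite size_map -cardE card_Sn size_permutations ?iota_uniq // size_iota.
by have := mem_eq t; rewrite mem_permutations tm => /mapP[pi _ ->]; exists pi.
Qed.

Lemma card_avoiders m E : all (fun tau => perm_eq tau (iota 1 4)) E ->
  #|[pred pi : {perm 'I_m} | all (fun tau => ~~ containsb pi tau) E]| = size (avoiders E m).
Proof.
move=> EP; rewrite cardE -(size_map (@positions m)).
apply/perm_size/uniq_perm; rewrite ?uniq_avoiders //.
  by rewrite map_inj_uniq ?enum_uniq //; apply: positions_inj.
move=> t; rewrite mem_avoiders; apply/mapP/andP => [[pi + ->]|[/mem_positions[pi ->] at_]].
  by rewrite mem_enum inE avoids_positions // perm_positions.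
by exists pi; rewrite // mem_enum inE avoids_positions.
Qed.

(** * Complementation of values *)

Definition perm_rev m : {perm 'I_m} := perm (@rev_ord_inj m).

Lemma perm_rev_mulK m (pi : {perm 'I_m}) : (pi * perm_rev m * perm_rev m)%g = pi.
Proof. by apply/permP => i; rewrite !permM !permE rev_ordK. Qed.

(** Places are unchanged while the order of values is reversed, so the value playing [5 - t] is the
    complement of the one playing [t]. *)
Lemma containsb_rev m (pi : {perm 'I_m}) tau : perm_eq tau (iota 1 4) ->
  containsb pi tau -> containsb (pi * perm_rev m)%g (map (subn 5) tau).
Proof.
move=> tauP /(containsP _ tauP)[v [v12 v23 v34 srt]].
have t5 (t : nat) : t \in tau -> 0 < t < 5 by rewrite (perm_mem tauP) mem_iota.
apply/containsP.
  by rewrite (perm_trans (perm_map (subn 5) tauP)).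
exists (fun t => rev_ord (v (5 - t))); split; try by rewrite /= ?subSS ?subn0; move: (ltn_ord (v 4)); lia.
move: srt; rewrite -map_comp; congr (sorted _ _); apply/eq_in_map => t /t5 t5' /=.
rewrite subKn; last by lia.
by rewrite invMg permM -[rev_ord _](permE (@rev_ord_inj m)) permK.
Qed.

Lemma card_complement m E : all (fun tau => perm_eq tau (iota 1 4)) E ->
  #|[pred pi : {perm 'I_m} | all (fun tau => ~~ containsb pi tau) E]| =
  #|[pred pi : {perm 'I_m} | all (fun tau => ~~ containsb pi tau) (map (map (subn 5)) E)]|.
Proof.
move=> /allP EP; rewrite -(card_image (mulIg (perm_rev m))); apply: eq_card => pi.
rewrite -[pi in LHS]perm_rev_mulK (mem_image (mulIg (perm_rev m))) !inE all_map.
apply: eq_in_all => tau /EP tauP /=; congr negb.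
have tau'P : perm_eq (map (subn 5) tau) (iota 1 4).
  by rewrite (perm_trans (perm_map (subn 5) tauP)).
apply/idP/idP => [/(containsb_rev tauP)|/(containsb_rev tau'P)].
  by rewrite perm_rev_mulK.
congr containsb; rewrite -map_comp -[RHS]map_id; apply/eq_in_map => t.
by rewrite (perm_mem tauP) mem_iota => t5 /=; rewrite subKn; lia.
Qed.

Theorem theorem4 (n : nat) (H : seq (seq nat)) :
  2 <= n -> H \in [:: H1; H2; H3; H4; H5] ->
  exists f : F13 n -> Av n.-1 H, bijective f.
Proof.
case: n => [|d] // _ HH; apply: eq_card_bij; rewrite card_F13 card_sig.
have count_eq E r keepL keepR (V : nat -> state -> nat) : all (fun tau => perm_eq tau (iota 1 4)) E ->
  sound E r keepL keepR -> (forall s, state_wf s -> V 0 s = 1) ->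
  (forall k s, state_wf s -> V k.+1 s = \sum_(0 <= a < s.2) V k (succ_state r s a)) ->
  V d (true, 1) = descendants d (true, 1) ->
  ballot3 d 0 = #|[pred pi : {perm 'I_d} | all (fun tau => ~~ containsb pi tau) E]|.
  move=> EP Sr V0 VS Vr; rewrite card_avoiders // (size_avoiders d Sr V0 VS) Vr.
  by rewrite descendants_root.
move: HH; rewrite !inE => /or4P[|||/orP[|]] /eqP->.
(* The first class is counted through its complement. *)
- rewrite card_complement //; exact: count_eq _ sound1 _ count_rule1 _.
- exact: count_eq _ sound2 _ count_rule2 _.
- exact: count_eq _ sound3 _ count_rule3 _.
- exact: count_eq _ sound4 _ count_rule4 _.
- by apply: count_eq _ sound5 _ count_rule5 _ => // -[[] k] _ //; rewrite /descendants5 /= muln0.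
Qed.
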